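(* Let the Dec-MTRL algorithm described in the context be run with $T_{gd}=C\kappa^2\log(1/\epsilon)$, $T_{pm}=C\kappa^2(\log d+\log\kappa)$ and $T_{con}=C\frac{1}{\log(1/\gamma(W))}(T_{gd}+\log(1/\epsilon)+\log d+\log L+\log\kappa)$, where $0<\epsilon<1$ is the desired error level and $C$ denotes numerical constants (possibly different at each occurrence). The time complexity of the algorithm is $$C\kappa^4\,\frac{1}{\log(1/\gamma(W))}\,\max\{\log^2(1/\epsilon),\log^2 d,\log^2\kappa,\log^2L\}\; nTdr.$$ Its communication complexity is $$C\kappa^4\,\frac{1}{\log(1/\gamma(W))}\,\max\{\log^2(1/\epsilon),\log^2 d,\log^2\kappa,\log^2L\}\cdot dr\,\big(\max_g k_g\big),$$ where $k_g$ is the degree of node $g$ in the communication graph.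
   Context: Setting: $T$ tasks with data $y_t=X_t\theta_t^\star$, $X_t\in\mathbb{R}^{n\times d}$, distributed over $L\le T$ nodes of a connected undirected graph $\mathcal G$; node $g$ holds the tasks in $\mathcal S_g$, with $\mathcal S_1,\dots,\mathcal S_L$ a partition of $[T]=\{1,\dots,T\}$. $\Theta^\star=[\theta_1^\star,\dots,\theta_T^\star]\in\mathbb{R}^{d\times T}$ has rank $r$ and condition number $\kappa$ (ratio of largest to smallest nonzero singular value). $W$ is the symmetric doubly stochastic $L\times L$ weight matrix used for consensus, and $\gamma(W)=\max(|\lambda_2(W)|,|\lambda_L(W)|)$, with $\lambda_k(W)$ the $k$-th largest eigenvalue. AvgCons: given $Z_{in}^{(g)}$, set $Z_0^{(g)}=Z_{in}^{(g)}$, iterate $Z^{(g)}_{\tau+1}=Z^{(g)}_\tau+\sum_{j\in\mathcal N_g}W_{gj}(Z^{(j)}_\tau-Z^{(g)}_\tau)$ for $T_{con}$ iterations ($\mathcal N_g$: neighbors of $g$) and output $L Z^{(g)}_{T_{con}}$; in each iteration every node receives the current matrix of each of its neighbors. Dec-MTRL algorithm. Initialization: node $g$ computes a scalar threshold via AvgCons, a $d\times|\mathcal S_g|$ matrix $(\Theta_0)_g=[\frac1nX_t^\top y_{t,trnc},t\in\mathcal S_g]$ ($y_{t,trnc}$: $y_t$ with entries of magnitude exceeding the square root of the threshold set to zero), and then runs $T_{pm}$ power-method iterations; each computes $(\Theta_0)_g(\Theta_0)_g^\top U^{(g)}$ at each node ($U^{(g)}$ is $d\times r$), runs AvgCons ($T_{con}$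 iterations) on these $d\times r$ matrices, a QR decomposition at node 1, and a second AvgCons to broadcast node 1's $d\times r$ matrix. Then $T_{gd}$ main (GDmin) iterations; in each, node $g$ computes, for $t\in\mathcal S_g$, $X_tU^{(g)}$, the least squares solution $b_t=(X_tU^{(g)})^\dagger y_t$ (with $M^\dagger=(M^\top M)^{-1}M^\top$), the gradient terms $X_t^\top(X_tU^{(g)}b_t-y_t)b_t^\top$, runs AvgCons ($T_{con}$ iterations) on the $d\times r$ partial gradient sums, and does a gradient step followed by a QR decomposition of a $d\times r$ matrix. Time complexity means $(T_{pm}T_{con})\varpi_{init}+(T_{gd}T_{con})\varpi_{gd}$, where $\varpi_{init}$ and $\varpi_{gd}$ are the times, order-wise and over all nodes, needed by one consensus iteration of the initialization and of the GDmin steps: $\varpi_{gd}=\max(T\cdot ndr,\,T\cdot nr^2,\,T\cdot ndr,\,L\cdot dr^2)=nTdr$ and $\varpi_{init}=nTdr$. Communication complexity refers to the number of scalars exchanged in the consensus iterations of the initialization and the main iterations; in each such iteration the nodes exchange $d\times r$ matrices with their neighbors. *)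

(* Defs.v *)
From HB Require Import structures.
From mathcomp Require Import all_boot all_order all_algebra.
From mathcomp Require Import polyrcf.
From mathcomp Require Import reals exp.

Set Implicit Arguments.
Unset Strict Implicit.
Unset Printing Implicit Defensive.

Import Order.TTheory GRing.Theory Num.Theory.
Local Open Scope ring_scope.

Section Spectrum.
Variable R : rcfType.

(* Real eigenvalues in nonincreasing order, repeated according to their
   algebraic multiplicity; for a symmetric matrix these are all of them. *)
Definition eigenvalues (m : nat) (A : 'M[R]_m) : seq R :=
  flatten [seq nseq (mup x (char_poly A)) x | x <- rev (rootsR (char_poly A))].

(* The k-th largest eigenvalue, counted from k = 1; it is 0 for k > m, so that
   gamma W = 1 for the single-node matrix W = 1. *)
Definition lambda (m : nat) (k : nat) (A : 'M[R]_m) : R :=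
  nth 0 (eigenvalues A) k.-1.

Definition gamma (L : nat) (W : 'M[R]_L) : R :=
  Num.max `|lambda 2 W| `|lambda L W|.

(* Nonincreasing. *)
Definition singular_values (m p : nat) (A : 'M[R]_(m, p)) : seq R :=
  [seq Num.sqrt x | x <- eigenvalues (A^T *m A)].

Definition condition_number (m p : nat) (A : 'M[R]_(m, p)) : R :=
  let s := [seq x <- singular_values A | x != 0] in head 0 s / last 0 s.

Definition is_doubly_stochastic (L : nat) (W : 'M[R]_L) : Prop :=
  [/\ forall i j, 0 <= W i j,
      forall i, \sum_j W i j = 1
    & forall j, \sum_i W i j = 1].

Definition is_upper_triangular (m : nat) (A : 'M[R]_m) : Prop :=
  forall i j : 'I_m, (j < i)%N -> A i j = 0.

(* qr returns the orthonormal factor of a thin QR decomposition. *)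
Definition is_QR (d r : nat) (qr : 'M[R]_(d, r) -> 'M[R]_(d, r)) : Prop :=
  forall A, (qr A)^T *m qr A = 1%:M /\
    exists2 U : 'M[R]_r, is_upper_triangular U & A = qr A *m U.

Definition pseudo_inverse (m p : nat) (M : 'M[R]_(m, p)) : 'M[R]_(p, m) :=
  invmx (M^T *m M) *m M^T.

End Spectrum.

Section Network.
Variable L : nat.

Definition is_partition (I : finType) (S : 'I_L -> {set I}) : Prop :=
  [/\ forall g, S g != set0,
      forall g h, g != h -> [disjoint S g & S h]
    & \bigcup_g S g = [set: I]].

Variable e : rel 'I_L.

Definition is_connected_graph : Prop :=
  [/\ symmetric e, irreflexive e & forall g h, connect e g h].

Definition neighbors (g : 'I_L) : {set 'I_L} := [set j | e g j].
Definition degree (g : 'I_L) : nat := #|neighbors g|.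
Definition max_degree : nat := (\max_(g < L) degree g)%N.

(* A distributed computation returns a value together with the number of
   scalars that each node has received while computing it. *)
Definition traffic : Type := 'I_L -> nat.
Definition distributed (A : Type) : Type := (A * traffic)%type.

Definition ret (A : Type) (a : A) : distributed A := (a, fun=> 0%N).

Definition bind (A B : Type) (m : distributed A) (f : A -> distributed B) :
    distributed B :=
  ((f m.1).1, fun g => (m.2 g + (f m.1).2 g)%N).

Fixpoint iterate (A : Type) (k : nat) (f : A -> distributed A) (a : A) :
    distributed A :=
  if k is k'.+1 then bind (f a) (iterate k' f) else ret a.

End Network.

Arguments ret {L A} a.

Notation "'do' x <- m ;; f" := (bind m (fun x => f))
  (at level 200, x name, m at level 100, f at level 200).

Section Consensus.
Variables (R : realType) (L : nat) (e : rel 'I_L) (W : 'M[R]_L).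

Definition consensus_step (p q : nat) (Z : 'I_L -> 'M[R]_(p, q)) :
    distributed L ('I_L -> 'M[R]_(p, q)) :=
  (fun g => Z g + \sum_(j in neighbors e g) W g j *: (Z j - Z g),
   fun g => (\sum_(j in neighbors e g) p * q)%N).

Definition AvgCons (p q Tcon : nat) (Zin : 'I_L -> 'M[R]_(p, q)) :
    distributed L ('I_L -> 'M[R]_(p, q)) :=
  do Z <- iterate Tcon (@consensus_step p q) Zin ;;
  ret (fun g => L%:R *: Z g).

End Consensus.

Section DecMTRL.
Variables (R : realType) (L T n d r : nat).
Variables (e : rel 'I_L) (W : 'M[R]_L) (node1 : 'I_L) (S : 'I_L -> {set 'I_T}).
Variables (X : 'I_T -> 'M[R]_(n, d)) (y : 'I_T -> 'cV[R]_n).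
Variable qr : 'M[R]_(d, r) -> 'M[R]_(d, r).
Variables (Tcon Tpm Tgd : nat).

Definition truncate (alpha : R) (v : 'cV[R]_n) : 'cV[R]_n :=
  map_mx (fun a => if `|a| <= Num.sqrt alpha then a else 0) v.

Definition Theta0 (alpha : R) (g : 'I_L) : 'M[R]_(d, #|S g|) :=
  \matrix_(i, k)
    (n%:R^-1 *: ((X (enum_val k))^T *m truncate alpha (y (enum_val k)))) i 0.

Definition power_iteration (alpha : 'I_L -> R) (U : 'I_L -> 'M[R]_(d, r)) :
    distributed L ('I_L -> 'M[R]_(d, r)) :=
  do V <- AvgCons e W Tcon
    (fun g => Theta0 (alpha g) g *m ((Theta0 (alpha g) g)^T *m U g)) ;;
  (* broadcast: all nodes but node 1 contribute zero to the sum *)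
  AvgCons e W Tcon (fun g => if g == node1 then qr (V node1) else 0).

(* alpha_in g is the contribution of node g to the threshold, and U0 the
   starting point of the power method. *)
Definition initialization (alpha_in : 'I_L -> R) (U0 : 'I_L -> 'M[R]_(d, r)) :
    distributed L ('I_L -> 'M[R]_(d, r)) :=
  do alpha <- AvgCons e W Tcon (fun g => (alpha_in g)%:M : 'M[R]_1) ;;
  iterate Tpm (power_iteration (fun g => alpha g 0 0)) U0.

Definition local_gradient (g : 'I_L) (U : 'M[R]_(d, r)) : 'M[R]_(d, r) :=
  \sum_(t in S g)
    let XU := X t *m U in
    let b := pseudo_inverse XU *m y t in
    (X t)^T *m (XU *m b - y t) *m b^T.

Definition GDmin_iteration (eta : R) (U : 'I_L -> 'M[R]_(d, r)) :
    distributed L ('I_L -> 'M[R]_(d, r)) :=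
  do grad <- AvgCons e W Tcon (fun g => local_gradient g (U g)) ;;
  ret (fun g => qr (U g - eta *: grad g)).

Definition Dec_MTRL (alpha_in : 'I_L -> R) (U0 : 'I_L -> 'M[R]_(d, r)) (eta : R) :
    distributed L ('I_L -> 'M[R]_(d, r)) :=
  do U <- initialization alpha_in U0 ;;
  iterate Tgd (GDmin_iteration eta) U.

End DecMTRL.

Section Complexity.

(* The number of scalars exchanged by the busiest node.  Edges are symmetric
   and exchanges are simultaneous, so each node also sends, to its neighbors
   together, as many scalars as it receives. *)
Definition communication_complexity (L : nat) (A : Type) (m : distributed L A) :
    nat :=
  (\max_(g < L) m.2 g)%N.

(* Order of the time of one consensus iteration of the initialization. *)
Definition init_order (n T d r : nat) : nat := (n * T * d * r)%N.

(* Order of the time of one consensus iteration of the GDmin steps: the products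
   X_t U, the least squares solutions, the gradients, the QR decompositions. *)
Definition gd_order (n T L d r : nat) : nat :=
  maxn (maxn (maxn (T * (n * d * r)) (T * (n * r ^ 2))) (T * (n * d * r)))
       (L * (d * r ^ 2)).

Variable R : realType.

Definition time_complexity (Tpm Tgd Tcon : nat) (w_init w_gd : R) : R :=
  (Tpm * Tcon)%:R * w_init + (Tgd * Tcon)%:R * w_gd.

(* kappa^4 / log(1/gamma) * max{log^2(1/eps), log^2 d, log^2 kappa, log^2 L} *)
Definition iteration_order (kappa gam eps : R) (d L : nat) : R :=
  kappa ^+ 4 * (1 / ln (1 / gam)) *
  Num.max (Num.max (Num.max (ln (1 / eps) ^+ 2) (ln d%:R ^+ 2))
                   (ln kappa ^+ 2))
          (ln L%:R ^+ 2).

End Complexity.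

(* Main.v *)
(* Both bounds reduce to (T_pm + T_gd) T_con <= C kappa^4 m^2 / log(1/gamma),
   where m is the largest of the logarithms: each of T_gd and T_pm is at most a
   constant times kappa^2 m, and so is the sum defining T_con.  Absorbing m into
   kappa^2 m needs kappa >= 1, that is, Theta^T Theta <> 0 must have a nonzero
   real eigenvalue; it comes from diagonalizing the matrix over R[i]. *)
Require Import Defs.
From mathcomp Require Import all_boot all_order all_algebra.
From mathcomp Require Import polyrcf complex.
From mathcomp Require Import reals exp.
From mathcomp Require Import ring lra.

Set Implicit Arguments.
Unset Strict Implicit.
Unset Printing Implicit Defensive.

Import Order.TTheory GRing.Theory Num.Theory.
Local Open Scope ring_scope.

(** * Spectrum of Gram matrices and the condition number *)

Lemma symmetric_nonzero_eigenvalue (F : rcfType) (m : nat) (A : 'M[F]_m) :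
  A^T = A -> A != 0 -> exists2 x, x != 0 & eigenvalue A x.
Proof.
move=> Asym A0; pose AC := map_mx (real_complex F) A.
have ACherm : AC \is hermsymmx.
  apply: realsym_hermsym.
    by apply/is_hermitianmxP; rewrite expr0 scale1r map_mx_id // map_trmx Asym.
  by apply/mxOverP => i j; rewrite mxE; apply/complex_realP; exists (A i j).
have /orthomx_spectralP ACE := hermitian_normalmx ACherm.
set P := spectralmx AC in ACE; set sp := spectral_diag AC in ACE.
have Punit : P \in unitmx := spectral_unit AC.
have : sp != 0.
  apply: contraNneq A0 => sp0; move: ACE.
  rewrite sp0 linear0 mulmx0 mul0mx => AC0.
  by rewrite -(map_mx_eq0 (real_complex F)) -/AC AC0.
move=> /rV0Pn [i spi0].
have /mxOverP/(_ 0 i)/complex_realP [x spix] := hermitian_spectral_diag_real ACherm.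
rewrite -/sp in spix; exists x.
  by apply: contraNneq spi0 => x0; rewrite spix x0.
(* The embedding of [F] into [F[i]] reflects roots of the characteristic polynomial, so a complex
   eigenvector for [x] suffices: row [i] of [P]. *)
rewrite eigenvalue_root_char -(fmorph_root (real_complex F)) map_char_poly -/AC.
rewrite -eigenvalue_root_char -[X in eigenvalue _ X]spix; apply/eigenvalueP; exists (row i P).
  by rewrite -row_mul {1}ACE -!mulmxA mulKVmx // row_mul row_diag_mx -scalemxAl -rowE.
apply: contraTneq Punit => Pi0.
by rewrite -row_free_unit; apply/row_freePn; exists i; rewrite Pi0 sub0mx.
Qed.

(** A row eigenvector v satisfies x |v|^2 = |v A^T|^2, with |v|^2 > 0. *)
Lemma eigenvalue_gram_ge0 (F : rcfType) (m p : nat) (A : 'M[F]_(m, p)) (x : F) :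
  eigenvalue (A^T *m A) x -> 0 <= x.
Proof.
have normE q (u : 'rV[F]_q) : (u *m u^T) 0 0 = \sum_j u 0 j ^+ 2.
  by rewrite mxE; apply: eq_bigr => j _; rewrite mxE expr2.
have norm_ge0 q (u : 'rV[F]_q) : 0 <= (u *m u^T) 0 0.
  by rewrite normE sumr_ge0 // => j _; rewrite sqr_ge0.
move=> /eigenvalueP [v vA v0].
have v_gt0 : 0 < (v *m v^T) 0 0.
  rewrite lt_def norm_ge0 andbT; apply: contraNneq v0 => /eqP.
  rewrite normE psumr_eq0 => [/allP vj0|j _]; last exact: sqr_ge0.
  apply/eqP/rowP => j; rewrite mxE; apply/eqP.
  by rewrite -sqrf_eq0; apply: vj0; rewrite mem_index_enum.
have := norm_ge0 _ (v *m A^T).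
by rewrite trmx_mul trmxK mulmxA -(mulmxA v) vA -scalemxAl mxE pmulr_lge0.
Qed.

(** The j-th diagonal entry of the Gram matrix is the squared norm of column j. *)
Lemma gram_neq0 (F : rcfType) (m p : nat) (A : 'M[F]_(m, p)) :
  A != 0 -> A^T *m A != 0.
Proof.
apply: contraNneq => /matrixP AA0; apply/eqP/matrixP => i j; apply/eqP.
move/eqP: (AA0 j j); rewrite !mxE psumr_eq0 => [/allP/(_ i)|k _].
  by rewrite mem_index_enum mxE -expr2 sqrf_eq0; apply.
by rewrite mxE -expr2 sqr_ge0.
Qed.

Lemma eigenvalues_mem (F : rcfType) (m : nat) (A : 'M[F]_m) (x : F) :
  eigenvalue A x -> x \in eigenvalues A.
Proof.
have p0 : char_poly A != 0 := monic_neq0 (char_poly_monic A).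
rewrite eigenvalue_root_char => rx; apply/flatten_mapP; exists x.
  rewrite mem_rev.
  by have /(_ x) := roots_on_rootsR p0; rewrite in_itv /= rx => <-.
by rewrite mem_nseq eqxx andbT -XsubC_dvd // dvdp_XsubCl.
Qed.

Lemma eigenvalues_sorted (F : rcfType) (m : nat) (A : 'M[F]_m) :
  sorted >=%R (eigenvalues A).
Proof.
have : sorted >=%R (rev (rootsR (char_poly A))).
  rewrite rev_sorted; apply: sub_sorted (sorted_roots _ _ _) => x z /=.
  exact: ltW.
rewrite /eigenvalues; have ge_trans := @ge_trans _ F.
(* The pairwise form splits over concatenation: each block is constant, and blocks compare as their
   roots do. *)
rewrite !(sorted_pairwise ge_trans); elim: (rev _) => //= x s IHs /andP [xs /IHs].
rewrite pairwise_cat => ->; rewrite andbT; apply/andP; split.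
  apply/allrelP => a b; rewrite mem_nseq => /andP [_ /eqP ->].
  by case/flatten_mapP => z zs; rewrite mem_nseq => /andP [_ /eqP ->]; apply: (allP xs).
elim: (mup _ _) => //= k ->; rewrite andbT.
by apply/allP => a; rewrite mem_nseq => /andP [_ /eqP ->]; exact: lexx.
Qed.

(** The list of nonzero singular values is positive and nonincreasing, so its head dominates its
    last element. It must be shown nonempty, as the default quotient 0 / 0 is 0. *)
Lemma condition_number_ge1 (F : rcfType) (m p : nat) (A : 'M[F]_(m, p)) :
  A != 0 -> 1 <= condition_number A.
Proof.
move=> A0; rewrite /condition_number; set s := filter _ _.
have s_sorted : sorted >=%R s.
  apply: sorted_filter; first exact: ge_trans.
  apply: (homo_sorted (e := >=%R)) (eigenvalues_sorted _) => x z /=.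
  exact: ler_wsqrtr.
have s_gt0 x : x \in s -> 0 < x.
  rewrite mem_filter lt_def => /andP [-> /mapP [z _ ->]].
  exact: sqrtr_ge0.
have [x x0 xe] : exists2 x, x != 0 & eigenvalue (A^T *m A) x.
  apply: symmetric_nonzero_eigenvalue (gram_neq0 A0).
  by rewrite trmx_mul trmxK.
have : Num.sqrt x \in s.
  rewrite mem_filter map_f ?eigenvalues_mem // andbT gt_eqF // sqrtr_gt0.
  by rewrite lt_def x0 (eigenvalue_gram_ge0 xe).
case: s s_sorted s_gt0 => // a s /= s_sorted s_gt0 _.
have last_gt0 := s_gt0 _ (mem_last a s).
rewrite ler_pdivlMr // mul1r.
have := mem_last a s; rewrite inE => /predU1P [-> //|].
exact: (allP (order_path_min (@ge_trans _ _) s_sorted)).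
Qed.

(** * Scalars received by each node *)

Section Traffic.
Variable L : nat.

(** Traffic is additive because the cost of the continuation does not depend on the value passed to
    it. *)
Lemma traffic_bind (A B : Type) (m : distributed L A)
    (f : A -> distributed L B) (g : 'I_L) (a b : nat) :
  m.2 g = a -> (forall x, (f x).2 g = b) -> (bind m f).2 g = (a + b)%N.
Proof. by move=> /= -> ->. Qed.

Lemma traffic_iterate (A : Type) (f : A -> distributed L A) (g : 'I_L) (c : nat) :
  (forall x, (f x).2 g = c) ->
  forall k x, (iterate k f x).2 g = (k * c)%N.
Proof. by move=> fc; elim=> //= k IHk x; rewrite fc IHk. Qed.

Lemma traffic_AvgCons (R : realType) (e : rel 'I_L) (W : 'M[R]_L) (p q Tcon : nat)
    (Z : 'I_L -> 'M[R]_(p, q)) (g : 'I_L) :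
  (AvgCons e W Tcon Z).2 g = (Tcon * (degree e g * (p * q)))%N.
Proof.
rewrite /= addn0; apply: traffic_iterate => x /=.
by rewrite sum_nat_const.
Qed.

Lemma traffic_Dec_MTRL (R : realType) (T n d r : nat) (e : rel 'I_L)
    (W : 'M[R]_L) node1 S (X : 'I_T -> 'M[R]_(n, d)) y qr Tcon Tpm Tgd
    alpha_in (U0 : 'I_L -> 'M[R]_(d, r)) eta (g : 'I_L) :
  (Dec_MTRL e W node1 S X y qr Tcon Tpm Tgd alpha_in U0 eta).2 g =
  (Tcon * degree e g * (1 + (Tpm.*2 + Tgd) * (d * r)))%N.
Proof.
set c := (Tcon * (degree e g * (d * r)))%N.
(* The sum mirrors the nesting of [bind]: the 1 x 1 threshold, two consensus runs per power
   iteration (average and broadcast), one per GDmin iteration followed by a free [ret]. *)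
have -> : (Tcon * degree e g * (1 + (Tpm.*2 + Tgd) * (d * r)) =
   Tcon * (degree e g * (1 * 1)) + Tpm * (c + c) + Tgd * (c + 0))%N.
  by rewrite /c -muln2; ring.
apply: traffic_bind => [|U].
  apply: traffic_bind => [|alpha]; first exact: traffic_AvgCons.
  apply: traffic_iterate => U.
  by apply: traffic_bind => [|V]; apply: traffic_AvgCons.
apply: traffic_iterate => {}U.
by apply: traffic_bind => //; apply: traffic_AvgCons.
Qed.

End Traffic.

(** * Estimates of iteration counts and of the cost per iteration *)

(** Squaring commutes with max on nonnegative numbers, so one [m] dominates all four logarithms. *)
Lemma sqr_max4 (R : realDomainType) (a b c f : R) :
  0 <= a -> 0 <= b -> 0 <= c -> 0 <= f ->
  exists m, [/\ a <= m, b <= m, c <= m & f <= m] /\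
    Num.max (Num.max (Num.max (a ^+ 2) (b ^+ 2)) (c ^+ 2)) (f ^+ 2) = m ^+ 2.
Proof.
move=> a0 b0 c0 f0; exists (Num.max (Num.max (Num.max a b) c) f).
have sqr_max (x z : R) : 0 <= x -> 0 <= z ->
    Num.max (x ^+ 2) (z ^+ 2) = Num.max x z ^+ 2.
  move=> x0 z0; case: (leP x z) => [xz|/ltW zx]; last first.
    by apply: max_l; rewrite ler_sqr.
  by apply: max_r; rewrite ler_sqr.
split; first by rewrite !le_max !lexx ?orbT.
by rewrite !sqr_max ?le_max ?a0 ?b0 ?c0.
Qed.

Lemma iteration_count_le (R : realType) (C0 Cgd Cpm Ccon kappa gam eps : R)
    (d L Tgd Tpm Tcon : nat) :
  0 < Cgd <= C0 -> 0 < Cpm <= C0 -> 0 < Ccon <= C0 ->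
  1 <= kappa -> 0 < eps < 1 ->
  Tgd%:R = Cgd * kappa ^+ 2 * ln (1 / eps) ->
  Tpm%:R = Cpm * kappa ^+ 2 * (ln d%:R + ln kappa) ->
  Tcon%:R = Ccon * (1 / ln (1 / gam)) *
    (Tgd%:R + ln (1 / eps) + ln d%:R + ln L%:R + ln kappa) ->
  (Tpm + Tgd)%:R * Tcon%:R
    <= 3 * C0 ^+ 2 * (C0 + 4) * iteration_order kappa gam eps d L /\
  (0 < Tgd)%N.
Proof.
move=> /andP [Cgd0 CgdC] /andP [Cpm0 CpmC] /andP [Ccon0 CconC] kappa1.
move=> /andP [eps0 eps1] TgdE TpmE TconE.
have ln_nat_ge0 k : 0 <= ln (k%:R : R).
  (* At 0 the default value of [ln] is 0. *)
  case: k => [|k]; first by rewrite ln0.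
  by rewrite ln_ge0 // ler1n.
have a0 : 0 < ln (1 / eps) by rewrite ln_gt0 // ltr_pdivlMr // mul1r.
have k0 := ln_ge0 kappa1.
have Tgd0 : 0 < (Tgd%:R : R).
  by rewrite TgdE !mulr_gt0 // (lt_le_trans ltr01).
split; last by rewrite -(ltr0n R).
rewrite /iteration_order.
move: (ln_nat_ge0 d) (ln_nat_ge0 L) TgdE TpmE TconE => b0 l0.
have [m [[am bm km lm] ->]] := sqr_max4 (ltW a0) b0 k0 l0.
(* Logarithms, and then kappa^2, become plain variables, which leaves polynomial inequalities for
   [lra] and [nra]. *)
move: (1 / ln (1 / gam)) (ln (1 / eps)) (ln d%:R) (ln L%:R) (ln kappa)
  a0 b0 l0 k0 am bm lm km => D a b l k a0 b0 l0 k0 am bm lm km TgdE TpmE TconE.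
have k2 : 1 <= kappa ^+ 2 by rewrite exprn_ege1.
rewrite (exprM kappa 2 2); move: (kappa ^+ 2) k2 TgdE TpmE => K K1 TgdE TpmE.
(* gamma > 1 would give D < 0, hence T_con < 0 since the sum is positive. *)
have D0 : 0 <= D.
  have : 0 <= (Tcon%:R : R) by [].
  by rewrite TconE pmulr_lge0 ?pmulr_rge0 //; lra.
have C00 : 0 < C0 by lra.
have m0 : 0 < m by lra.
have Km0 : 0 <= K * m by nra.
have mKm : m <= K * m by nra.
have TgdK : Tgd%:R <= C0 * (K * m).
  rewrite TgdE -mulrA; apply: ler_pM => //; [lra|nra|nra].
have TpmK : Tpm%:R <= 2 * C0 * (K * m).
  rewrite TpmE -mulrA (mulrC 2) -mulrA; apply: ler_pM => //; [lra|nra|nra].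
(* In [C0 + 4], the [C0] comes from the summand T_gd and the 4 from the four logarithms, each at
   most [K * m]. *)
have TconK : Tcon%:R <= C0 * D * ((C0 + 4) * (K * m)).
  rewrite TconE; apply: ler_pM; [nra|lra|nra|nra].
rewrite natrD.
(* The 3 adds the factor 1 of T_gd and the factor 2 of T_pm, whose bracket holds two logarithms. *)
have -> : 3 * C0 ^+ 2 * (C0 + 4) * (K ^+ 2 * D * m ^+ 2) =
    (3 * C0 * (K * m)) * (C0 * D * ((C0 + 4) * (K * m))) by ring.
by apply: ler_pM => //; [rewrite addr_ge0 | lra].
Qed.

(** The term n r^2 is absorbed by r <= d, and L d r^2 by L <= T together with r <= n. *)
Lemma gd_order_le (n T L d r : nat) :
  (r <= n)%N -> (r <= d)%N -> (L <= T)%N -> (gd_order n T L d r <= n * T * d * r)%N.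
Proof.
move=> rn rd LT; rewrite /gd_order !geq_max.
have -> : (n * T * d * r = T * (n * d * r))%N by ring.
rewrite leqnn andbT /=; apply/andP; split.
  by rewrite leq_mul // -mulnA leq_mul // -mulnn leq_mul.
by rewrite leq_mul // (mulnC n) -mulnA leq_mul // -mulnn leq_mul.
Qed.

(** [C0] caps all numerical constants of the parameters; [C] depends on it alone, hence is uniform
    in the problem and the network. *)
Theorem corollary4p2 (R : realType) (C0 : R) (hC0 : 0 < C0) :
  exists2 C : R, 0 < C &
  forall (L T n d r : nat)
    (e : rel 'I_L) (he : is_connected_graph e)
    (W : 'M[R]_L) (hWsym : W^T = W) (hW : is_doubly_stochastic W)
    (node1 : 'I_L) (hnode1 : node1 = 0%N :> nat)
    (hLT : (L <= T)%N)
    (S : 'I_L -> {set 'I_T}) (hS : is_partition S)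
    (Theta : 'M[R]_(d, T)) (hr0 : (0 < r)%N) (hr : \rank Theta = r)
    (hrn : (r <= n)%N)
    (X : 'I_T -> 'M[R]_(n, d)) (y : 'I_T -> 'cV[R]_n)
    (hy : forall t, y t = X t *m col t Theta)
    (qr : 'M[R]_(d, r) -> 'M[R]_(d, r)) (hqr : is_QR qr)
    (alpha_in : 'I_L -> R) (U0 : 'I_L -> 'M[R]_(d, r)) (eta : R)
    (eps : R) (heps : 0 < eps < 1)
    (Tgd Tpm Tcon : nat)
    (Cgd Cpm Ccon : R)
    (hCgd : 0 < Cgd <= C0) (hCpm : 0 < Cpm <= C0) (hCcon : 0 < Ccon <= C0)
    (w_init w_gd : R) (Cw_init Cw_gd : R)
    (hCw_init : 0 < Cw_init <= C0) (hCw_gd : 0 < Cw_gd <= C0),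
  let kappa := condition_number Theta in
  let gam := gamma W in
  Tgd%:R = Cgd * kappa ^+ 2 * ln (1 / eps) ->
  Tpm%:R = Cpm * kappa ^+ 2 * (ln d%:R + ln kappa) ->
  Tcon%:R = Ccon * (1 / ln (1 / gam)) *
    (Tgd%:R + ln (1 / eps) + ln d%:R + ln L%:R + ln kappa) ->
  w_init = Cw_init * (init_order n T d r)%:R ->
  w_gd = Cw_gd * (gd_order n T L d r)%:R ->
  time_complexity Tpm Tgd Tcon w_init w_gd
    <= C * iteration_order kappa gam eps d L * (n * T * d * r)%:R
  /\
  (communication_complexity
     (Dec_MTRL e W node1 S X y qr Tcon Tpm Tgd alpha_in U0 eta))%:R
    <= C * iteration_order kappa gam eps d L * (d * r * max_degree e)%:R.
Proof.
pose K := 3 * C0 ^+ 2 * (C0 + 4).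
have K0 : 0 < K by rewrite !mulr_gt0 ?exprn_gt0 ?addr_gt0.
(* [K * C0] serves the time bound, where an iteration costs at most [C0] nTdr; [K * 2] serves the
   communication bound. *)
exists (K * (C0 + 2)); first by rewrite mulr_gt0 ?addr_gt0.
move=> L T n d r e _ W _ _ node1 _ LT S _ Theta r0 rE rn X y _ qr _ alpha_in U0 eta
  eps heps Tgd Tpm Tcon Cgd Cpm Ccon hCgd hCpm hCcon w_init w_gd Cw_init Cw_gd
  /andP [Ci0 CiC] /andP [Cg0 CgC] kappa gam TgdE TpmE TconE w_initE w_gdE.
have rd : (r <= d)%N by rewrite -rE rank_leq_row.
have kappa1 : 1 <= kappa.
  by apply: condition_number_ge1; rewrite -mxrank_eq0 rE -lt0n.
have [] := iteration_count_le hCgd hCpm hCcon kappa1 heps TgdE TpmE TconE.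
rewrite -/K; set I := iteration_order _ _ _ _ _ => count_le Tgd_gt0.
clearbody K I.
(* The sign is read off [count_le]: [K * I] bounds a nonnegative count. *)
have I0 : 0 <= I.
  by rewrite -(pmulr_rge0 _ K0) (le_trans _ count_le) ?mulr_ge0.
split.
  set V : R := (n * T * d * r)%:R.
  have w_init_le : w_init <= C0 * V.
    by rewrite w_initE ler_wpM2r.
  have w_gd_le : w_gd <= C0 * V.
    by rewrite w_gdE ler_pM ?ler_nat ?gd_order_le // ltW.
  apply: le_trans (_ : (Tpm + Tgd)%:R * Tcon%:R * (C0 * V) <= _).
    by rewrite natrD !mulrDl -!natrM lerD // ler_wpM2l.
  apply: le_trans (ler_wpM2r _ count_le) _; first by rewrite mulr_ge0 // ltW.
  have -> : K * (C0 + 2) * I * V = K * I * (C0 * V) + 2 * (K * I * V) by ring.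
  by rewrite lerDl !mulr_ge0 // ltW.
set D := Dec_MTRL _ _ _ _ _ _ _ _ _ _ _ _ _.
(* The factor 2 covers the two consensus runs of a power iteration. *)
have comm_le : (communication_complexity D <=
    2 * ((Tpm + Tgd) * Tcon) * (d * r * max_degree e))%N.
  apply/bigmax_leqP => g _; rewrite traffic_Dec_MTRL.
  have deg_le : (degree e g <= max_degree e)%N by apply: leq_bigmax.
  have dr0 : (0 < d * r)%N by rewrite muln_gt0 r0 (leq_trans r0 rd).
  apply: leq_trans (leq_mul (leq_mul (leqnn Tcon) deg_le)
    (_ : _ <= (Tpm + Tgd).*2 * (d * r))%N) _.
    (* T_gd >= 1 pays for the consensus on the scalar threshold. *)
    have -> : ((Tpm + Tgd).*2 * (d * r) = Tgd * (d * r) + (Tpm.*2 + Tgd) * (d * r))%N.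
      by rewrite -!muln2; ring.
    by rewrite leq_add2r muln_gt0 Tgd_gt0.
  by apply/eq_leq; rewrite -muln2; ring.
apply: le_trans (_ : 2 * ((Tpm + Tgd)%:R * Tcon%:R) * (d * r * max_degree e)%:R <= _).
  by rewrite -!natrM ler_nat.
rewrite ler_wpM2r //.
have -> : K * (C0 + 2) * I = 2 * (K * I) + C0 * (K * I) by ring.
apply: le_trans (ler_wpM2l _ count_le) _ => //.
by rewrite lerDl !mulr_ge0 // ltW.
Qed.
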